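(* Let $(I,\mathbb A,\mathbb T,W)$ be action path SDF data on an exogenous scenario space $(\Omega,\mathcal E)$, and let $(F,\pi,\mathbf X)$ be the induced action path SDF candidate. Then $(F,\pi,\mathbf X)$ is an order consistent and maximal stochastic decision forest on $(\Omega,\mathcal E)$. Moreover, it is surely non-trivial if and only if for all $\omega\in\Omega$ there are $f,f'\in\mathbb A^{\mathbb T}$ with $f\neq f'$ and $(\omega,f),(\omega,f')\in W$.
   Context: **Order theory.** In a poset $(N,\ge)$, $\uparrow x=\{y\in N\mid y\ge x\}$ and $\downarrow x=\{y\in N\mid x\ge y\}$. A chain is a totally ordered subset; a maximal chain is a chain maximal w.r.t. inclusion. A poset $(F,\ge)$ is a forest iff every $\uparrow x$ is a chain; a forest is rooted iff $F\ne\emptyset$ and for every $x\in F$, $\uparrow x$ contains a maximal element of $(F,\ge)$. A tree is a forest with $(\uparrow x)\cap(\uparrow y)\neq\emptyset$ for all $x,y$. Any forest has a unique partition into trees such that $x\ge y$ implies that $x,y$ lie in the same member; the members are the connected components. In a rooted forest each component has a maximum, called its root. Elements of a forest are nodes; a node $x$ is terminal iff $\downarrow x=\{x\}$; a move is a non-terminal node. A rooted forest is everywhere non-trivial iff every root is a move. **Decision forest on a set $W$.** A subset $F\subseteq\mathcal P(W)$ such that (1) $(F,\supseteq)$ is a rooted forest, and (2) if $\mathcal W$ denotes the set of maximal chains of $(F,\supseteq)$ and $\mathcal W(y)=\{w\in\mathcal W\mid y\in w\}$ for $y\in F$, there is a bijection $h\colon W\to\mathcal W$ with $\{h(v)\mid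 v\in y\}=\mathcal W(y)$ for every $y\in F$. $X$ denotes the set of moves of $(F,\supseteq)$. **Stochastic decision forest (SDF).** An exogenous scenario space is a measurable space $(\Omega,\mathcal E)$ with $\Omega\ne\emptyset$. An SDF on it is a triple $(F,\pi,\mathbf X)$ consisting of: (1) a decision forest $F$ on some set $W$; (2) a surjection $\pi\colon F\to\Omega$ such that the set of connected components of $(F,\supseteq)$ is $\{\pi^{-1}(\{\omega\})\mid\omega\in\Omega\}$; (3) a set $\mathbf X$ such that (a) each $\mathbf x\in\mathbf X$ is a map $\mathbf x\colon D_{\mathbf x}\to X$ with $D_{\mathbf x}\in\mathcal E\setminus\{\emptyset\}$ and $\pi\circ\mathbf x=\mathrm{id}_{D_{\mathbf x}}$, and (b) $\{\mathbf x(\omega)\mid\mathbf x\in\mathbf X,\ \omega\in D_{\mathbf x}\}=X$. Put $\mathbf x_1\ge_{\mathbf X}\mathbf x_2$ iff $D_{\mathbf x_1}\supseteq D_{\mathbf x_2}$ and $\mathbf x_1(\omega)\supseteq\mathbf x_2(\omega)$ for all $\omega\in D_{\mathbf x_2}$. The SDF is *order consistent* iff for all $\mathbf x_1,\mathbf x_2\in\mathbf X$: if there is $\omega\in D_{\mathbf x_1}\cap D_{\mathbf x_2}$ with $\mathbf x_1(\omega)\supseteq\mathbf x_2(\omega)$, then $\mathbf x_1\ge_{\mathbf X}\mathbf x_2$. It is *surely non-trivial* iff $(F,\supseteq)$ is everywhere non-trivial. An order consistent SDF is *maximal* iff for every set $\bar{\mathbf X}$ such that $(F,\pi,\bar{\mathbf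 X})$ is an order consistent SDF and such that every $\bar{\mathbf x}\in\bar{\mathbf X}$ is of the form $\bar{\mathbf x}=\bigcup P_{\bar{\mathbf x}}$ for some $P_{\bar{\mathbf x}}\subseteq\mathbf X$ (maps being identified with their graphs), one has $\bar{\mathbf X}=\mathbf X$. **Action path setting.** $(\mathbb T,\le)$ is a totally ordered set with minimum $0$; $[0,t)_{\mathbb T}=\{u\in\mathbb T\mid u<t\}$. $I$ is a non-empty finite set, $(\mathbb A^i)_{i\in I}$ is a family of non-empty metric spaces, $\mathbb A=\prod_{i\in I}\mathbb A^i$ is their topological product. $W\subseteq\Omega\times\mathbb A^{\mathbb T}$ is such that for every $\omega\in\Omega$ there is $f\in\mathbb A^{\mathbb T}$ with $(\omega,f)\in W$. For $t\in\mathbb T$ and $(\omega,f)\in\Omega\times\mathbb A^{\mathbb T}$ let $$x_t(\omega,f)=\{(\omega',f')\in W\mid \omega'=\omega,\ f'|_{[0,t)_{\mathbb T}}=f|_{[0,t)_{\mathbb T}}\}.$$ Let $F=\{x_t(w)\mid t\in\mathbb T,\ w\in W\}\cup\{\{w\}\mid w\in W\}$, let $\pi\colon F\to\Omega$ map $x\in F$ to the common first component of its elements, and for $(t,f)\in\mathbb T\times\mathbb A^{\mathbb T}$ let $D_{t,f}=\{\omega\in\Omega\mid |x_t(\omega,f)|\ge2\}$. Let $\mathbf X$ be the set of maps $\mathbf x_t(f)\colon D_{t,f}\to F,\ \omega\mapsto x_t(\omega,f)$, over all $t\in\mathbb T$, $f\in\mathbb A^{\mathbb T}$ with $D_{t,f}\neq\emptyset$.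 $(I,\mathbb A,\mathbb T,W)$ is called *action path SDF data* on $(\Omega,\mathcal E)$ iff: - (AP.SDF0) $D_{t,f}\in\mathcal E$ for all $t\in\mathbb T$, $f\in\mathbb A^{\mathbb T}$; - (AP.SDF1) for all $w\in W$ and $t,u\in\mathbb T$ with $t\ne u$ and $x_t(w)=x_u(w)$, we have $x_t(w)=\{w\}$; - (AP.SDF2) for all $\omega\in\Omega$, $\tilde f\in\mathbb A^{\mathbb T}$ and all subsets $\mathbb T'\subseteq\mathbb T$ with $x_t(\omega,\tilde f)\in F$ for all $t\in\mathbb T'$, there is $f\in\mathbb A^{\mathbb T}$ with $(\omega,f)\in W$ and $f|_{[0,t)_{\mathbb T}}=\tilde f|_{[0,t)_{\mathbb T}}$ for all $t\in\mathbb T'$; - (AP.SDF3) for all $t\in\mathbb T$ and $f,g\in\mathbb A^{\mathbb T}$ with $D_{t,f},D_{t,g}\ne\emptyset$ and $D_{t,f}\cap D_{t,g}=\emptyset$, there is $u\in[0,t)_{\mathbb T}$ with $D_{u,f}\cap D_{u,g}\ne\emptyset$ and $f|_{[0,u)_{\mathbb T}}\ne g|_{[0,u)_{\mathbb T}}$. $(F,\pi,\mathbf X)$ is then called the induced action path SDF candidate. *)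

(* Defs.v *)
From HB Require Import structures.
From mathcomp Require Import all_boot all_order all_algebra.
From mathcomp Require Import all_classical reals topology measure.

Set Implicit Arguments.
Unset Strict Implicit.
Unset Printing Implicit Defensive.

Import Order.TTheory.

Local Open Scope classical_set_scope.

(* Posets are given by a carrier [N : set T] and a relation [ge], read        *)
(* [ge x y] as "x >= y"; only the restriction of [ge] to [N] matters.         *)
Section OrderTheory.
Context {T : Type}.
Implicit Types (N C c : set T) (ge : T -> T -> Prop) (x y m r : T).

Definition is_poset N ge :=
  [/\ forall x, N x -> ge x x,
      forall x y, N x -> N y -> ge x y -> ge y x -> x = y
    & forall x y z, N x -> N y -> N z -> ge x y -> ge y z -> ge x z].

Definition up_set N ge x : set T := [set y | N y /\ ge y x].

Definition down_set N ge x : set T := [set y | N y /\ ge x y].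

Definition is_chain N ge c := c `<=` N /\ total_on c ge.

Definition maximal_chains N ge : set (set T) :=
  [set c | is_chain N ge c /\
           forall c', is_chain N ge c' -> c `<=` c' -> c' = c].

Definition is_maximal N ge m := N m /\ forall y, N y -> ge y m -> y = m.

Definition is_maximum N ge m := N m /\ forall y, N y -> ge m y.

Definition is_forest N ge :=
  is_poset N ge /\ forall x, N x -> is_chain N ge (up_set N ge x).

Definition is_rooted_forest N ge :=
  [/\ is_forest N ge, N !=set0 &
      forall x, N x -> exists2 m, up_set N ge x m & is_maximal N ge m].

Definition is_tree N ge :=
  is_forest N ge /\
  forall x y, N x -> N y -> (up_set N ge x `&` up_set N ge y) !=set0.

Definition is_tree_partition N ge (P : set (set T)) :=
  [/\ partition P id N,
      forall C, P C -> is_tree C ge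
    & forall x y, N x -> N y -> ge x y -> exists C, [/\ P C, C x & C y]].

(* A forest has exactly one tree partition (see [tree_partition_exists] and   *)
(* [connected_componentsE] below), so this is the set of its members.         *)
Definition connected_components N ge : set (set T) :=
  [set C | exists2 P, is_tree_partition N ge P & P C].

Definition is_root N ge r :=
  exists2 C, connected_components N ge C & is_maximum C ge r.

Definition is_terminal N ge x := N x /\ down_set N ge x = [set x].

Definition moves N ge : set T := [set x | N x /\ ~ is_terminal N ge x].

Definition everywhere_nontrivial N ge :=
  forall r, is_root N ge r -> moves N ge r.

Lemma tree_partition_class N ge P C x : is_tree_partition N ge P -> P C ->
  C x -> C = [set y | N y /\ (up_set N ge x `&` up_set N ge y) !=set0].
Proof.
move=> [[cov triv _] trP samP] PC Cx.
have CN D z : P D -> D z -> N z by move=> PD Dz; rewrite -cov; exists D.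
apply/seteqP; split => [y Cy|y [Ny [z [[Nz gzx] [_ gzy]]]]].
- split; first exact: CN Cy.
  have [_ /(_ x y Cx Cy) [z [[Cz gzx] [_ gzy]]]] := trP C PC.
  by exists z; do !split => //; apply: CN Cz.
- have [D [PD Dz Dx]] := samP z x Nz (CN _ _ PC Cx) gzx.
  have [E [PE Ez Ey]] := samP z y Nz Ny gzy.
  have -> : C = D by apply: triv => //; exists x.
  by have -> : D = E by apply: triv => //; exists z.
Qed.

Lemma connected_componentsE N ge P :
  is_tree_partition N ge P -> connected_components N ge = P.
Proof.
move=> tP; apply/seteqP; split => [C [Q tQ QC]|C PC]; last by exists P.
have [[covQ _ neQ] _ _] := tQ.
have [x Cx] := neQ C QC.
have Nx : N x by rewrite -covQ; exists C.
have [[covP _ _] _ _] := tP.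
have [D PD Dx] : cover P id x by rewrite covP.
by rewrite (tree_partition_class tQ QC Cx) -(tree_partition_class tP PD Dx).
Qed.

Lemma tree_partition_exists N ge :
  is_forest N ge -> exists P, is_tree_partition N ge P.
Proof.
move=> [[rf anti tr] chU].
pose K x := [set y | N y /\ (up_set N ge x `&` up_set N ge y) !=set0].
have Kxx x : N x -> K x x by move=> Nx; split=> //; exists x; do !split=> //; exact: rf.
have Kall x y z : N x -> K x y -> K x z -> (up_set N ge y `&` up_set N ge z) !=set0.
  move=> Nx [Ny [u [[Nu ux] [_ uy]]]] [Nz [v [[Nv vx] [_ vz]]]].
  have [_ /(_ u v) tot] := chU x Nx.
  case: tot => // guv; [exists u|exists v]; do !split => //;
    [exact: (tr u v z)|exact: (tr v u y)].
have Ksym x y : N x -> K x y -> K y x.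
  move=> Nx [Ny [u [? ?]]]; split=> //; by exists u.
exists [set K x | x in N]; split.
- split.
  + apply/seteqP; split => [y [_ [x Nx <-] []]//|x Nx].
    by exists (K x); [exists x|exact: Kxx].
  + move=> _ _ [x Nx <-] [y Ny <-] [z [/= xz yz]].
    apply/seteqP; split => w Kw; split; try by case: Kw.
    * have Kzw : K z w.
        by split; [case: Kw|exact: (Kall x)].
      by apply: (Kall z) Kzw; [case: xz|exact: Ksym].
    * have Kzw : K z w.
        by split; [case: Kw|exact: (Kall y)].
      by apply: (Kall z) Kzw; [case: xz|exact: Ksym].
  + by move=> _ [x Nx <-]; exists x; exact: Kxx.
- move=> _ [x Nx <-]; have KN y : K x y -> N y by case.
  have Kup y z : K x y -> N z -> ge z y -> K x z.
    move=> Kxy Nz gzy; split=> //.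
    have Ny := KN _ Kxy.
    case: Kxy => _ [u [[Nu ux] [_ uy]]].
    have [_ /(_ u z) tot] := chU y Ny.
    case: tot => // g; [exists u|exists z]; do !split => //;
      [exact: (tr z u x)|exact: rf].
  split.
  + split; first split.
    * by move=> y /KN; exact: rf.
    * by move=> y z /KN Ny /KN Nz; exact: anti.
    * by move=> y z w /KN Ny /KN Nz /KN Nw; exact: tr.
    * move=> y Ky; split; first by move=> z [].
      move=> u v [/KN Nu gu] [/KN Nv gv].
      by have [_] := chU y (KN _ Ky); apply.
  + move=> y z Ky Kz.
    have [u [[Nu uy] [_ uz]]] := Kall x y z Nx Ky Kz.
    by have Kxu := Kup y u Ky Nu uy; exists u.
- move=> x y Nx Ny gxy; exists (K x); split; [by exists x|exact: Kxx|].
  by split=> //; exists x; do !split=> //; exact: rf.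
Qed.

End OrderTheory.

Definition supset {V : Type} (x y : set V) : Prop := y `<=` x.

Definition is_decision_forest {V : Type} (W : set V) (F : set (set V)) :=
  [/\ F `<=` [set y | y `<=` W],
      is_rooted_forest F supset &
      exists2 h : V -> set (set V),
        set_bij W (maximal_chains F supset) h &
        forall y, F y ->
          [set h v | v in y] = [set c | maximal_chains F supset c /\ c y]].

(* A map x : D_x -> F is identified with its graph: [x (w, y)] means          *)
(* x(w) = y, and the domain D_x is the projection [x.`1].                     *)
Section StochasticDecisionForest.
Context {d : measure_display} {Omega : measurableType d} {V : Type}.
Implicit Types (F : set (set V)) (pi : set V -> Omega)
  (x : set (Omega * set V)) (X : set (set (Omega * set V))).

Definition is_random_move F pi x :=
  [/\ forall w y y', x (w, y) -> x (w, y') -> y = y',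
      measurable x.`1,
      x.`1 !=set0,
      forall w y, x (w, y) -> moves F supset y
    & forall w y, x (w, y) -> pi y = w].

(* [pi] is only relevant on [F]. *)
Definition is_sdf F pi X :=
  [/\ exists W : set V, is_decision_forest W F,
      set_surj F [set: Omega] pi,
      connected_components F supset =
        [set F `&` pi @^-1` [set w] | w in [set: Omega]],
      forall x, X x -> is_random_move F pi x
    & [set y | exists2 x, X x & exists w, x (w, y)] = moves F supset].

Definition random_move_ge x1 x2 :=
  x2.`1 `<=` x1.`1 /\
  forall w y1 y2, x1 (w, y1) -> x2 (w, y2) -> y2 `<=` y1.

Definition order_consistent X :=
  forall x1 x2, X x1 -> X x2 ->
    (exists w y1 y2, [/\ x1 (w, y1), x2 (w, y2) & y2 `<=` y1]) ->
    random_move_ge x1 x2.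

Definition is_maximal_sdf F pi X :=
  forall X' : set (set (Omega * set V)),
    is_sdf F pi X' -> order_consistent X' ->
    (forall x', X' x' -> exists2 P, P `<=` X & x' = \bigcup_(x in P) x) ->
    X' = X.

Definition surely_nontrivial F := everywhere_nontrivial F supset.

End StochasticDecisionForest.

(* [Omega] is non-empty because a [measurableType] is pointed; the minimum of *)
(* [T] is the [\bot] of its [bOrderType] structure.                           *)
Section ActionPath.
Context {d : measure_display} {Omega : measurableType d} {R : realType}
  {I : finType} {A : I -> metricType R}
  {dT : Order.disp_t} {T : bOrderType dT}.

Let paths := T -> prod_topology A.

Implicit Types (W : set (Omega * paths)) (f g : paths) (t u : T) (w : Omega).

(* f and g have the same restriction to [0, t). *)
Definition eq_before t f g := forall u, (u < t)%O -> f u = g u.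

Definition ap_node W t (v : Omega * paths) : set (Omega * paths) :=
  [set v' | [/\ W v', v'.1 = v.1 & eq_before t v'.2 v.2]].

Definition ap_forest W : set (set (Omega * paths)) :=
  [set x | (exists t, exists2 v, W v & x = ap_node W t v) \/
           (exists2 v, W v & x = [set v])].

(* On [ap_forest W] the projection [x.`1] is a singleton, and [get] returns   *)
(* its element.                                                               *)
Definition ap_proj (x : set (Omega * paths)) : Omega := get x.`1.

Definition ap_dom W t f : set Omega :=
  [set w | (`I_2 #<= ap_node W t (w, f))%card].

Definition ap_random_move W t f : set (Omega * set (Omega * paths)) :=
  [set p | ap_dom W t f p.1 /\ p.2 = ap_node W t (p.1, f)].

Definition ap_random_moves W : set (set (Omega * set (Omega * paths))) :=
  [set x | exists t f, ap_dom W t f !=set0 /\ x = ap_random_move W t f].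

Record is_action_path_sdf_data W : Prop := {
  ap_players_nonempty : inhabited I ;
  ap_actions_nonempty : forall i, inhabited (A i) ;
  ap_outcomes : forall w, exists f, W (w, f) ;
  ap_sdf0 : forall t f, measurable (ap_dom W t f) ;
  ap_sdf1 : forall v t u, W v -> t <> u ->
    ap_node W t v = ap_node W u v -> ap_node W t v = [set v] ;
  ap_sdf2 : forall w g (T' : set T),
    (forall t, T' t -> ap_forest W (ap_node W t (w, g))) ->
    exists2 f, W (w, f) & forall t, T' t -> eq_before t f g ;
  ap_sdf3 : forall t f g,
    ap_dom W t f !=set0 -> ap_dom W t g !=set0 ->
    ap_dom W t f `&` ap_dom W t g = set0 ->
    exists u, [/\ (u < t)%O, (ap_dom W u f `&` ap_dom W u g) !=set0
                & ~ eq_before u f g]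
}.

End ActionPath.

(* Main.v *)
(* Write [F_v] for the set of nodes containing the outcome [v].  A node that  *)
(* contains [v] is [x_t(v)] for some [t] or [{v}], so [F_v] is a chain, and   *)
(* [v |-> F_v] enumerates the maximal chains: AP.SDF2 applied to a chain      *)
(* without singletons yields an outcome common to all its members.            *)
(*                                                                            *)
(* Order consistency rests on AP.SDF1: if [x_u(w, g)] is not a singleton and  *)
(* is a subset of [x_t(w, f)], then [t <= u] and [f = g] on [0, t), a         *)
(* condition in which [w] no longer occurs.                                   *)
(*                                                                            *)
(* For maximality, let [x'] be a member of the coarser system [X'] extending  *)
(* [x_t(f)] and [x_u(g)], with [t <= u].  Every random move has an extension  *)
(* in [X'].  If [D_{t,f}] meets [D_{t,g}], the extension of [x_t(g)] lies     *)
(* above [x'], so that [f = g] on [0, t); it then agrees with [x'] on         *)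
(* [D_{t,f}], hence is [x'], and AP.SDF1 gives [t = u].  If not, AP.SDF3      *)
(* provides [x_s(f)] and [x_s(g)], [s < t], that are incomparable in a common *)
(* scenario, although both have extensions in [X'] above [x'], and such       *)
(* members of [X'] are comparable.                                            *)
Require Import Defs.
From HB Require Import structures.
From mathcomp Require Import all_boot all_order all_algebra.
From mathcomp Require Import all_classical reals topology measure.

Set Implicit Arguments.
Unset Strict Implicit.
Unset Printing Implicit Defensive.

Import Order.TTheory.

Local Open Scope classical_set_scope.

(** Two facts carry the proof. Nodes that share an outcome are comparable ([ap_forest_comparable]),
    and inclusion between non-singleton nodes of one scenario is decided by levels and initial
    segments of paths, independently of the scenario ([ap_dom_node_level]). The first makes [F] a
    forest, and gluing the initial segments along a maximal chain ([maximal_chain_outcome]) matches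
    chains with outcomes. The second gives order consistency and, with AP.SDF3, forces all parts of
    a member of a coarsening to coincide ([coarsening_parts_eq]), whence maximality. The node at
    level [\bot] imposes no condition on paths: it holds all outcomes of its scenario. Hence it is
    the root of that scenario's component, and a move exactly when the scenario has two outcomes. *)

Lemma card_ge2P (V : Type) (B : set V) :
  (`I_2 #<= B)%card <-> exists a b, [/\ B a, B b & a <> b].
Proof.
split=> [leB|[a [b [Ba Bb neq]]]].
- apply: contrapT => noB.
  have [a Ba] : B !=set0.
    apply/set0P/eqP => B0; move: leB; rewrite B0 card_le0 => /eqP.
    by move=> /seteqP [/(_ 0%N)] /(_ isT).
  have eB : B = [set a].
    apply/seteqP; split => [b Bb|_ ->//].
    by apply: contrapT => nab; apply: noB; exists b, a.
  have /andP[+ _] : (B #<= `I_1)%card && (`I_1 #<= B)%card.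
    by rewrite -card_eq_le eB card_set1.
  by move=> /(card_le_trans leB); rewrite card_le_II.
- pose h n := if n is 0%N then a else b.
  have injh : {in `I_2 &, injective h}.
    by move=> [|[|n]] [|[|m]]; rewrite ?inE //= => _ _ /esym // /esym.
  have /andP[_ le2] : (h @` `I_2 #<= `I_2)%card && (`I_2 #<= h @` `I_2)%card.
    by rewrite -card_eq_le; exact: inj_card_eq.
  by apply: card_le_trans le2 (subset_card_le _) => _ [[|n] _ <-].
Qed.

(** A common point of the graphs puts each map above the other, so domains agree, and values agree
    by antisymmetry of inclusion. It serves both the induced system and its coarsenings. *)
Lemma order_consistent_inj {d : measure_display} {Omega : measurableType d}
    {V : Type} (X : set (set (Omega * set V))) x1 x2 w y :
  order_consistent X -> X x1 -> X x2 -> x1 (w, y) -> x2 (w, y) -> x1 = x2.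
Proof.
move=> oc.
have sub z1 z2 : X z1 -> X z2 -> z1 (w, y) -> z2 (w, y) -> z1 `<=` z2.
  move=> Xz1 Xz2 z1w z2w.
  have [|_ ge12] := oc z1 z2 Xz1 Xz2.
    by exists w, y, y; split=> //; exact: subset_refl.
  have [|dom ge21] := oc z2 z1 Xz2 Xz1.
    by exists w, y, y; split=> //; exact: subset_refl.
  move=> [w' y1] z1w'; have [|y2 z2w'] := dom w'; first by exists y1.
  suff -> : y1 = y2 by [].
  apply/seteqP.
  by split; [exact: (ge21 w' y2 y1)|exact: (ge12 w' y1 y2)].
by move=> *; apply/seteqP; split; exact: sub.
Qed.

Section ActionPathSDF.
Context {d : measure_display} {Omega : measurableType d} {R : realType}
  {I : finType} {A : I -> metricType R}
  {dT : Order.disp_t} {T : bOrderType dT}.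

Local Notation paths := (T -> prod_topology A).
Implicit Types (f g : paths) (t u : T) (w : Omega) (v : Omega * paths)
  (y : set (Omega * paths)).

(** * Nodes, moves and domains *)

Lemma eq_before_sym t f g : eq_before t f g -> eq_before t g f.
Proof. by move=> fg s st; rewrite fg. Qed.

Lemma eq_before_trans t f g h :
  eq_before t f g -> eq_before t g h -> eq_before t f h.
Proof. by move=> fg gh s st; rewrite fg // gh. Qed.

Lemma eq_before_le t u f g :
  (t <= u)%O -> eq_before u f g -> eq_before t f g.
Proof. by move=> tu fg s st; apply: fg; exact: lt_le_trans tu. Qed.

Context (W : set (Omega * paths)).
Local Notation F := (ap_forest W).
Local Notation proj := (@ap_proj d Omega R I A dT T).

Lemma ap_node_refl t v : W v -> ap_node W t v v.
Proof. by []. Qed.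

Lemma ap_node_sub_outcomes t v : ap_node W t v `<=` W.
Proof. by move=> v' []. Qed.

Lemma ap_node_eq_before t w f g :
  eq_before t f g -> ap_node W t (w, f) = ap_node W t (w, g).
Proof.
move=> fg; apply/seteqP; split => v [Wv vw vf]; split => //=.
  exact: eq_before_trans fg.
by apply: eq_before_trans vf _; exact: eq_before_sym.
Qed.

Lemma ap_node_eq t v v' : ap_node W t v v' -> ap_node W t v = ap_node W t v'.
Proof.
case: v v' => [w f] [w' f'] [/= _ -> ff'].
by apply: ap_node_eq_before; exact: eq_before_sym.
Qed.

Lemma ap_node_le t u v :
  (t <= u)%O -> ap_node W u v `<=` ap_node W t v.
Proof. by move=> tu v' [Wv vw vf]; split=> //; exact: eq_before_le vf. Qed.

Lemma ap_forest_node t v : W v -> F (ap_node W t v).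
Proof. by move=> Wv; left; exists t, v. Qed.

Lemma ap_forest_set1 v : W v -> F [set v].
Proof. by move=> Wv; right; exists v. Qed.

Lemma ap_forest_sub_outcomes y : F y -> y `<=` W.
Proof.
case=> [[t [v Wv ->]]|[v Wv ->]]; first exact: ap_node_sub_outcomes.
by move=> _ ->.
Qed.

Lemma ap_forest_nonempty y : F y -> y !=set0.
Proof.
case=> [[t [v Wv ->]]|[v Wv ->]]; exists v => //; exact: ap_node_refl.
Qed.

Lemma ap_forest_at y v :
  F y -> y v -> y = [set v] \/ exists t, y = ap_node W t v.
Proof.
case=> [[t [v' Wv' ->]]|[v' Wv' ->]] yv; last by left; rewrite yv.
by right; exists t; exact: ap_node_eq.
Qed.

Lemma ap_forest_comparable y y' v :
  F y -> F y' -> y v -> y' v -> supset y y' \/ supset y' y.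
Proof.
move=> Fy Fy' yv y'v.
have [yE|[t yE]] := ap_forest_at Fy yv; first by right=> z; rewrite yE => ->.
have [y'E|[u y'E]] := ap_forest_at Fy' y'v.
  by left=> z; rewrite y'E => ->.
by rewrite yE y'E; have [tu|ut] := leP t u; [left|right];
  apply: ap_node_le => //; exact: ltW.
Qed.

Lemma ap_forest_sub_set1 y v : F y -> y `<=` [set v] -> y = [set v].
Proof.
move=> Fy yv; have [v' yv'] := ap_forest_nonempty Fy.
by apply/seteqP; split=> // _ ->; rewrite -(yv _ yv').
Qed.

Lemma ap_forest_same_scenario y v v' : F y -> y v -> y v' -> v'.1 = v.1.
Proof.
move=> Fy yv; have [->|[t ->]] := ap_forest_at Fy yv; first by move=> ->.
by case.
Qed.

Lemma ap_forest_root y v : F y -> y v -> y `<=` ap_node W \bot%O v.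
Proof.
move=> Fy yv v' yv'; split; first exact: ap_forest_sub_outcomes yv'.
  exact: ap_forest_same_scenario yv'.
by move=> s; rewrite ltx0.
Qed.

Lemma ap_proj_at y v : F y -> y v -> ap_proj y = v.1.
Proof.
move=> Fy yv; apply: get_unique.
  by exists v.2; rewrite -surjective_pairing.
by move=> w [f yf]; exact: (ap_forest_same_scenario Fy yv yf).
Qed.

Lemma supset_poset (N : set (set (Omega * paths))) : is_poset N supset.
Proof.
split => [x _|x y _ _ yx xy|x y z _ _ _ yx zy]; first exact: subset_refl.
  by apply/seteqP.
exact: subset_trans yx.
Qed.

(** Nodes above a given node share its outcomes, hence are comparable. A general [N] covers the
    connected components too. *)
Lemma ap_forest_forest (N : set (set (Omega * paths))) :
  N `<=` F -> is_forest N supset.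
Proof.
move=> NF; split; first exact: supset_poset.
move=> x /NF Fx; split=> [y []//|y z [/NF Fy xy] [/NF Fz xz]].
have [v xv] := ap_forest_nonempty Fx.
by apply: (ap_forest_comparable (v := v)) => //; [exact: xy|exact: xz].
Qed.

(** Maximality comes from the member [[set v]]: a non-empty node comparable with it contains [v]. *)
Lemma ap_forest_maximal_chain v : W v ->
  maximal_chains F supset [set y | F y /\ y v].
Proof.
move=> Wv; split.
  split=> [y []//|y z [Fy yv] [Fz zv]]; exact: ap_forest_comparable yv zv.
move=> c [cF ctot] sub; apply/seteqP; split=> // y cy; split; first exact: cF.
have [yv|yv] := ctot y [set v] cy (sub _ (conj (ap_forest_set1 Wv) erefl)).
  exact: yv.
by rewrite (ap_forest_sub_set1 (cF _ cy) yv).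
Qed.

Lemma ap_forest_terminal_set1 v : W v -> is_terminal F supset [set v].
Proof.
move=> Wv; split; first exact: ap_forest_set1.
apply/seteqP; split=> [y [Fy yv]|_ ->]; first exact: ap_forest_sub_set1.
by split; [exact: ap_forest_set1|exact: subset_refl].
Qed.

Lemma ap_forest_movesP y :
  moves F supset y <-> F y /\ exists v v', [/\ y v, y v' & v <> v'].
Proof.
split=> [[Fy nterm]|[Fy [v [v' [yv yv' neq]]]]]; split=> //.
- apply: contrapT => no2; apply: nterm.
  have [v yv] := ap_forest_nonempty Fy.
  suff -> : y = [set v].
    by apply: ap_forest_terminal_set1; exact: ap_forest_sub_outcomes yv.
  apply: ap_forest_sub_set1 => // v' yv'.
  by apply: contrapT => neq; apply: no2; exists v, v'; split=> // e; exact: neq.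
- case=> _ dE.
  have : down_set F supset y [set v].
    split; last by move=> _ ->.
    by apply: ap_forest_set1; exact: ap_forest_sub_outcomes yv.
  by rewrite dE => ye; apply: neq; move: yv'; rewrite -ye => ->.
Qed.

Lemma ap_domP t f w :
  ap_dom W t f w <->
  exists v v', [/\ ap_node W t (w, f) v, ap_node W t (w, f) v' & v <> v'].
Proof. exact: card_ge2P. Qed.

Lemma ap_dom_forest t f w : ap_dom W t f w -> F (ap_node W t (w, f)).
Proof.
move=> /ap_domP [v [_ [yv _ _]]]; rewrite (ap_node_eq yv).
by apply: ap_forest_node; case: yv.
Qed.

Lemma ap_dom_move t f w :
  ap_dom W t f w -> moves F supset (ap_node W t (w, f)).
Proof.
by move=> D; apply/ap_forest_movesP; split;
  [exact: ap_dom_forest|exact/ap_domP].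
Qed.

Lemma ap_dom_sub t u f g w w' :
  ap_node W u (w', g) `<=` ap_node W t (w, f) -> ap_dom W u g w' ->
  ap_dom W t f w.
Proof.
move=> sub /ap_domP [v [v' [yv yv' n]]]; apply/ap_domP; exists v, v'.
by split=> //; exact: sub.
Qed.

Lemma ap_dom_le t u f w : (t <= u)%O -> ap_dom W u f w -> ap_dom W t f w.
Proof. by move=> tu; apply: ap_dom_sub; exact: ap_node_le. Qed.

Lemma ap_dom_proj t f w :
  ap_dom W t f w -> ap_proj (ap_node W t (w, f)) = w.
Proof.
move=> D; have /ap_domP [v [_ [yv _ _]]] := D.
by rewrite (ap_proj_at (ap_dom_forest D) yv); case: yv.
Qed.

Lemma ap_move_dom y : moves F supset y ->
  exists t w f, ap_dom W t f w /\ y = ap_node W t (w, f).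
Proof.
move=> /ap_forest_movesP [Fy [v [v' [yv yv' neq]]]].
have [yE|[t yE]] := ap_forest_at Fy yv.
  by move: yv'; rewrite yE => e; case: neq.
exists t, v.1, v.2; rewrite -surjective_pairing; split=> //.
by apply/ap_domP; rewrite -surjective_pairing -yE; exists v, v'.
Qed.

(** * Maximal chains, components and order consistency *)

Hypothesis data : is_action_path_sdf_data W.

(** If [u < t], the nodes at both levels coincide, and AP.SDF1 makes them a singleton, contrary to
    [ap_dom W u g w]. The paths are then compared through a common outcome. *)
Lemma ap_dom_node_level t u f g w :
  ap_dom W u g w -> ap_node W u (w, g) `<=` ap_node W t (w, f) ->
  (t <= u)%O /\ eq_before t f g.
Proof.
move=> D sub; have /ap_domP [v [v' [yv yv' neq]]] := D.
have tu : (t <= u)%O.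
  have [//|ut] := leP t u; exfalso.
  have Wv : W v by case: yv.
  have uE := ap_node_eq yv; have tE := ap_node_eq (sub _ yv).
  have e : ap_node W u v = ap_node W t v.
    apply/seteqP; split; first by rewrite -uE -tE.
    by apply: ap_node_le; exact: ltW.
  have n : u <> t by move=> E; move: ut; rewrite E ltxx.
  have := ap_sdf1 data Wv n e; rewrite -uE => E.
  by move: yv'; rewrite E => /esym.
split=> //; have [_ _ vf] := sub _ yv; have [_ _ vg] := yv.
by apply: eq_before_trans (eq_before_sym vf) (eq_before_le tu vg).
Qed.

Lemma maximal_chain_outcome c :
  maximal_chains F supset c -> exists2 v, W v & forall y, c y -> y v.
Proof.
move=> [[cF ctot] cmax].
have [[v Wv cv]|nosing] := pselect (exists2 v, W v & c [set v]).
  exists v => // y cy; have [yv|yv] := ctot _ _ cy cv; first exact: yv.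
  by rewrite (ap_forest_sub_set1 (cF _ cy) yv).
have cnode y v : c y -> y v -> exists t, y = ap_node W t v.
  move=> cy yv; have [yE|//] := ap_forest_at (cF _ cy) yv.
  case: nosing; exists v; last by rewrite -yE.
  exact: ap_forest_sub_outcomes (cF _ cy) _ yv.
have [y0 cy0] : c !=set0.
  (* The empty chain is not maximal: it extends to the chain with one singleton node. *)
  apply/set0P/eqP => c0.
  have [f Wf] := ap_outcomes data point.
  suff : [set [set (point, f)]] = c.
    by rewrite c0 => /seteqP [/(_ _ erefl)].
  apply: cmax; last by rewrite c0.
  split=> [_ ->|_ _ -> ->]; first exact: ap_forest_set1.
  by left; exact: subset_refl.
have [v0 yv0] := ap_forest_nonempty (cF _ cy0).
(* The values at [s] of the initial segments that define members of [c]. *)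
pose piece s a := exists t v, [/\ c (ap_node W t v), W v, (s < t)%O & v.2 s = a].
have pieceP s a b : piece s a -> piece s b -> a = b.
  move=> [t [v [cv Wv st <-]]] [t' [v' [cv' Wv' st' <-]]].
  have [sub|sub] := ctot _ _ cv cv'.
    by have [_ _ /(_ s st)] := sub _ (ap_node_refl t' Wv').
  by have [_ _ /(_ s st')] := sub _ (ap_node_refl t Wv).
(* The default [v0.2 s] only fills in times [s] that no initial segment covers. *)
pose g s := xget (v0.2 s) (piece s).
have gE t v : c (ap_node W t v) -> W v -> eq_before t v.2 g.
  move=> cv Wv s st; have gl : piece s (v.2 s) by exists t, v.
  exact: (pieceP _ _ _ gl (xgetI _ gl)).
have scen y v : c y -> y v -> v.1 = v0.1.
  move=> cy yv; have [sub|sub] := ctot _ _ cy cy0.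
    by have := ap_forest_same_scenario (cF _ cy) yv (sub _ yv0).
  exact: ap_forest_same_scenario (cF _ cy0) yv0 (sub _ yv).
have nodeE t v : c (ap_node W t v) -> W v ->
    ap_node W t (v0.1, g) = ap_node W t v.
  move=> cv Wv; rewrite -(scen _ _ cv (ap_node_refl t Wv)).
  rewrite -(ap_node_eq_before _ (gE _ _ cv Wv)).
  by rewrite -surjective_pairing.
have [|f Wf fg] := ap_sdf2 data (w := v0.1) (g := g)
  (T' := [set t | exists2 v, W v & c (ap_node W t v)]).
  by move=> t [v Wv cv]; rewrite (nodeE _ _ cv Wv); exact: ap_forest_node.
exists (v0.1, f) => // y cy.
have [v yv] := ap_forest_nonempty (cF _ cy).
have [t yE] := cnode _ _ cy yv.
have Wv := ap_forest_sub_outcomes (cF _ cy) yv.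
have cv : c (ap_node W t v) by rewrite -yE.
by rewrite yE -(nodeE _ _ cv Wv); split=> //; apply: fg; exists v.
Qed.

Lemma ap_maximal_chainsE c : maximal_chains F supset c <->
  exists2 v, W v & c = [set y | F y /\ y v].
Proof.
split=> [mc|[v Wv ->]]; last exact: ap_forest_maximal_chain.
have [v Wv cv] := maximal_chain_outcome mc; exists v => //.
have [[cF _] cmax] := mc; apply/esym/cmax.
  by have [] := ap_forest_maximal_chain Wv.
by move=> y cy; split; [exact: cF|exact: cv].
Qed.

Lemma ap_decision_forest : is_decision_forest W F.
Proof.
split; first exact: ap_forest_sub_outcomes.
- split; first exact: ap_forest_forest.
    have [f Wf] := ap_outcomes data point.
    by exists [set (point, f)]; exact: ap_forest_set1.
  move=> x Fx; have [v xv] := ap_forest_nonempty Fx.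
  have Wv := ap_forest_sub_outcomes Fx xv.
  exists (ap_node W \bot%O v).
    by split; [exact: ap_forest_node|exact: ap_forest_root].
  split; first exact: ap_forest_node.
  move=> y Fy sub; apply/seteqP; split=> //; apply: ap_forest_root => //.
  by apply: sub; exact: ap_node_refl.
- exists (fun v => [set y | F y /\ y v]).
    split.
    + by move=> v Wv; exact: ap_forest_maximal_chain.
    + move=> v v'; rewrite !inE => Wv Wv' e.
      have : [set y | F y /\ y v'] [set v].
        by rewrite -e; split=> //; exact: ap_forest_set1.
      by case.
    + by move=> c /ap_maximal_chainsE [v Wv ->]; exists v.
  move=> y Fy; apply/seteqP; split=> [_ [v yv <-]|c [/ap_maximal_chainsE]].
    split=> //; apply: ap_forest_maximal_chain.
    exact: ap_forest_sub_outcomes yv.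
  by move=> [v Wv ->] [_ yv]; exists v.
Qed.

(** Tree partitions are unique, so it suffices that the fibres of [proj] form one. Two nodes of a
    fibre lie below the [\bot] node of its scenario, and inclusion preserves the scenario. *)
Lemma ap_connected_components :
  connected_components F supset =
  [set F `&` proj @^-1` [set w] | w in [set: Omega]].
Proof.
apply: connected_componentsE; split.
- split.
  + apply/seteqP; split=> [y [_ [w _ <-] []]//|y Fy].
    by exists (F `&` proj @^-1` [set ap_proj y]) => //; exists (ap_proj y).
  + by move=> _ _ [w _ <-] [w' _ <-] [y [[_ /= <-] [_ /= <-]]].
  + move=> _ [w _ <-]; have [f Wf] := ap_outcomes data w.
    exists [set (w, f)]; split; first exact: ap_forest_set1.
    exact: (ap_proj_at (ap_forest_set1 Wf) erefl).
- move=> _ [w _ <-]; split; first by apply: ap_forest_forest => y [].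
  move=> x y [Fx xw] [Fy yw].
  have [v xv] := ap_forest_nonempty Fx; have [v' yv'] := ap_forest_nonempty Fy.
  have Wv := ap_forest_sub_outcomes Fx xv.
  have Fr := ap_forest_node \bot%O Wv.
  have rw : ap_proj (ap_node W \bot%O v) = w.
    by rewrite (ap_proj_at Fr (ap_node_refl _ Wv)) -xw (ap_proj_at Fx xv).
  exists (ap_node W \bot%O v); split; split=> //; first exact: ap_forest_root.
  have sv : ap_node W \bot%O v v'.
    split; first exact: ap_forest_sub_outcomes yv'.
      by rewrite -(ap_proj_at Fy yv') -(ap_proj_at Fx xv) xw yw.
    by move=> s; rewrite ltx0.
  by rewrite (ap_node_eq sv); exact: ap_forest_root.
- move=> x y Fx Fy yx.
  exists (F `&` proj @^-1` [set proj x]).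
  split; [by exists (proj x)|by []|split=> //=].
  have [v yv] := ap_forest_nonempty Fy.
  by rewrite (ap_proj_at Fy yv) (ap_proj_at Fx (yx _ yv)).
Qed.

Lemma ap_sdf : is_sdf F ap_proj (ap_random_moves W).
Proof.
split.
- by exists W; exact: ap_decision_forest.
- move=> w _; have [f Wf] := ap_outcomes data w.
  exists [set (w, f)]; first exact: ap_forest_set1.
  exact: (ap_proj_at (ap_forest_set1 Wf) erefl).
- exact: ap_connected_components.
- move=> _ [t [f [ne ->]]].
  have domE : (ap_random_move W t f).`1 = ap_dom W t f.
    apply/seteqP; split=> [w [y [] //]|w D].
    by exists (ap_node W t (w, f)).
  split; rewrite ?domE //.
  + by move=> w y y' [_ /= ->] [_ /= ->].
  + exact: ap_sdf0 data t f.
  + by move=> w y [/= D ->]; exact: ap_dom_move.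
  + by move=> w y [/= D ->]; exact: ap_dom_proj.
- apply/seteqP; split=> [y [_ [t [f [_ ->]]] [w [/= D ->]]]|y /ap_move_dom].
    exact: ap_dom_move.
  move=> [t [w [f [D ->]]]]; exists (ap_random_move W t f); last by exists w.
  by exists t, f; split=> //; exists w.
Qed.

Lemma ap_order_consistent : order_consistent (ap_random_moves W).
Proof.
move=> _ _ [t [f [_ ->]]] [u [g [_ ->]]] [w [_ [_ [[/= _ ->] [/= Dg ->] sub]]]].
have [tu fg] := ap_dom_node_level Dg sub.
have le w' : ap_node W u (w', g) `<=` ap_node W t (w', f).
  by rewrite (ap_node_eq_before _ fg); exact: ap_node_le.
split=> [w' [y [/= D _]]|w' _ _ [/= _ ->] [/= _ ->]]; last exact: le.
by exists (ap_node W t (w', f)); split=> //; exact: ap_dom_sub (le w') D.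
Qed.

Lemma ap_random_movesI t f w :
  ap_dom W t f w -> ap_random_moves W (ap_random_move W t f).
Proof. by move=> D; exists t, f; split=> //; exists w. Qed.

(** * Maximality *)

Section Coarsening.
Variable X' : set (set (Omega * set (Omega * paths))).
Hypothesis sdfX' : is_sdf F ap_proj X'.
Hypothesis ocX' : order_consistent X'.
Hypothesis unionX' : forall x', X' x' ->
  exists2 P, P `<=` ap_random_moves W & x' = \bigcup_(x in P) x.

(** Some [z] in [X'] takes the move [ap_node W t (w, f)] as a value; the part of [z] through that
    point is [ap_random_move W t f] by [order_consistent_inj]. *)
Lemma coarsening_lift t f w : ap_dom W t f w ->
  exists2 z, X' z & ap_random_move W t f `<=` z.
Proof.
move=> D; have [_ _ _ rmX' covX'] := sdfX'.
have := ap_dom_move D; rewrite -covX' => -[z X'z [w' zw']].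
exists z => //; have [P PX zE] := unionX' X'z.
have [_ _ _ _ /(_ _ _ zw')] := rmX' z X'z; rewrite (ap_dom_proj D) => ww'.
move: zw'; rewrite zE -ww' => -[p Pp pw].
have <- : p = ap_random_move W t f.
  apply: (order_consistent_inj ap_order_consistent _ _ pw) => //.
  - exact: PX.
  - exact: ap_random_movesI D.
by move=> q pq; exists p.
Qed.

Lemma coarsening_parts_eq x' t u f g : X' x' -> (t <= u)%O ->
  ap_dom W t f !=set0 -> ap_dom W u g !=set0 ->
  ap_random_move W t f `<=` x' -> ap_random_move W u g `<=` x' ->
  ap_random_move W t f = ap_random_move W u g.
Proof.
move=> X'x' tu [wf Df] [wg Dg] fx' gx'.
have [_ _ _ rmX' _] := sdfX'.
(* In scenario [wh], [z] takes the value at level [s], which contains the value of [x'] at level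
   [r]; order consistency spreads this to all scenarios. *)
have lift_ge h s r wh z : ap_dom W r h wh -> ap_random_move W r h `<=` x' ->
    (s <= r)%O -> X' z -> ap_random_move W s h `<=` z -> random_move_ge z x'.
  move=> D rx' sr X'z sz; apply: ocX' => //.
  exists wh, (ap_node W s (wh, h)), (ap_node W r (wh, h)); split.
  - by apply: sz; split=> //; exact: ap_dom_le D.
  - exact: rx'.
  - exact: ap_node_le.
have [meet|disj] := pselect ((ap_dom W t f `&` ap_dom W t g) !=set0).
- have [w [Dfw Dgw]] := meet.
  have [z X'z tz] := coarsening_lift Dgw.
  have [_ zx'] := lift_ge _ _ _ _ _ Dg gx' tu X'z tz.
  have [_ gf] : (t <= t)%O /\ eq_before t g f.
    apply: (ap_dom_node_level (w := w)) => //.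
    by apply: zx' (tz (w, _) _) (fx' (w, _) _).
  have mE : ap_random_move W t f = ap_random_move W t g.
    apply/seteqP; split=> -[w' y] [/= D ->].
      have e := ap_node_eq_before w' gf.
      by split=> //=; rewrite ?e //; apply: ap_dom_sub D; rewrite e.
    have e := ap_node_eq_before w' gf.
    by split=> //=; rewrite -?e //; apply: ap_dom_sub D; rewrite e.
  have zE : z = x'.
    apply: (order_consistent_inj ocX' (w := wf)
      (y := ap_node W t (wf, f))) => //.
      by apply: tz; rewrite -mE.
    exact: fx'.
  have [fun' _ _ _ _] := rmX' _ X'x'.
  (* Since [z = x'], the map [x'] has both nodes as its value at [wg]. *)
  have e : ap_node W u (wg, g) = ap_node W t (wg, g).
    apply: (fun' wg); first exact: gx'.
    by rewrite -zE; apply: tz; split=> //; exact: ap_dom_le Dg.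
  have [ut _] : (u <= t)%O /\ eq_before u g g.
    apply: (ap_dom_node_level (w := wg)) (ap_dom_le tu Dg) _.
    by rewrite e.
  by rewrite mE; have -> : t = u by apply/eqP; rewrite eq_le tu ut.
- have [|||v [vt [w [Dfw Dgw]] nfg]] := @ap_sdf3 _ _ _ _ _ _ _ _ data t f g.
  + by exists wf.
  + by exists wg; exact: ap_dom_le Dg.
  + by apply: contrapT => /eqP/set0P.
  exfalso; apply: nfg.
  have [zf X'zf fz] := coarsening_lift Dfw.
  have [zg X'zg gz] := coarsening_lift Dgw.
  have [domf gef] := lift_ge _ _ _ _ _ Df fx' (ltW vt) X'zf fz.
  have [domg geg] := lift_ge _ _ _ _ _ Dg gx' (ltW (lt_le_trans vt tu)) X'zg gz.
  have x'w : x' (wf, ap_node W t (wf, f)) by exact: fx'.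
  have [yf zfw] : zf.`1 wf by apply: domf; exists (ap_node W t (wf, f)).
  have [yg zgw] : zg.`1 wf by apply: domg; exists (ap_node W t (wf, f)).
  have subf := gef _ _ _ zfw x'w; have subg := geg _ _ _ zgw x'w.
  have [_ _ _ mvf _] := rmX' _ X'zf; have [_ _ _ mvg _] := rmX' _ X'zg.
  have [[Fyf _] [Fyg _]] := (mvf _ _ zfw, mvg _ _ zgw).
  have [o oE] := ap_forest_nonempty (ap_dom_forest Df).
  have zfw' : zf (w, ap_node W v (w, f)) by exact: fz.
  have zgw' : zg (w, ap_node W v (w, g)) by exact: gz.
  (* At [wf] both values contain the outcome [o], so they are comparable. Order consistency carries
     this to [w], where it forces [f] and [g] to agree before [v]. *)
  have [sub|sub] := ap_forest_comparable Fyf Fyg (subf _ oE) (subg _ oE).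
    have [|_ ge] := ocX' X'zf X'zg; first by exists wf, yf, yg.
    by have [] := ap_dom_node_level Dgw (ge _ _ _ zfw' zgw').
  have [|_ ge] := ocX' X'zg X'zf; first by exists wf, yg, yf.
  have [_] := ap_dom_node_level Dfw (ge _ _ _ zgw' zfw').
  exact: eq_before_sym.
Qed.

Lemma coarsening_sub : X' `<=` ap_random_moves W.
Proof.
move=> x' X'x'; have [_ _ _ rmX' _] := sdfX'.
have [_ _ [w [y x'w]] _ _] := rmX' _ X'x'.
have [P PX x'E] := unionX' X'x'.
have Px p : P p -> p `<=` x' by move=> Pp q pq; rewrite x'E; exists p.
have [p Pp pw] : (\bigcup_(x in P) x) (w, y) by rewrite -x'E.
suff -> : x' = p by exact: PX.
apply/seteqP; split; last exact: Px.
rewrite x'E; apply: bigcup_sub => q Pq.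
have [t [f [nef pE]]] := PX _ Pp; have [u [g [neg qE]]] := PX _ Pq.
have fx' := Px _ Pp; have gx' := Px _ Pq; rewrite pE in fx'; rewrite qE in gx'.
rewrite pE qE; have [tu|ut] := leP t u.
  by rewrite (coarsening_parts_eq X'x' tu nef neg fx' gx').
by rewrite (coarsening_parts_eq X'x' (ltW ut) neg nef gx' fx').
Qed.

(** For the converse inclusion, the lift of a random move is itself a random move by
    [coarsening_sub], and the two share a point. *)
Lemma coarsening_eq : X' = ap_random_moves W.
Proof.
apply/seteqP; split; first exact: coarsening_sub.
move=> _ [t [f [[w D] ->]]]; have [z X'z tz] := coarsening_lift D.
suff -> : ap_random_move W t f = z by [].
apply: (order_consistent_inj ap_order_consistent (w := w)
  (y := ap_node W t (w, f))).
- exact: ap_random_movesI D.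
- exact: coarsening_sub.
- by [].
- exact: tz.
Qed.

End Coarsening.

Lemma ap_maximal_sdf : is_maximal_sdf F ap_proj (ap_random_moves W).
Proof. by move=> X'; exact: coarsening_eq. Qed.

(** * Roots and sure non-triviality *)

Lemma ap_rootP y : is_root F supset y <->
  exists2 v, W v & y = ap_node W \bot%O v.
Proof.
rewrite /is_root ap_connected_components; split.
- move=> [_ [w _ <-] [[Fy yw] ymax]].
  have [v yv] := ap_forest_nonempty Fy; have Wv := ap_forest_sub_outcomes Fy yv.
  exists v => //; apply/seteqP; split; first exact: ap_forest_root.
  apply: ymax; split; first exact: ap_forest_node.
  rewrite -yw /= (ap_proj_at Fy yv).
  exact: (ap_proj_at (ap_forest_node _ Wv) (ap_node_refl _ Wv)).
- move=> [v Wv ->]; have Fr := ap_forest_node \bot%O Wv.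
  exists (F `&` proj @^-1` [set v.1]); first by exists v.1.
  split; first by split=> //; exact: ap_proj_at Fr (ap_node_refl _ Wv).
  move=> z [Fz /= zv]; have [v' zv'] := ap_forest_nonempty Fz.
  rewrite (ap_node_eq (v' := v')); first exact: ap_forest_root.
  split; first exact: ap_forest_sub_outcomes zv'.
    by rewrite -zv (ap_proj_at Fz zv').
  by move=> s; rewrite ltx0.
Qed.

Lemma ap_surely_nontrivialP : surely_nontrivial F <->
  forall w, exists f f', [/\ f <> f', W (w, f) & W (w, f')].
Proof.
split=> [nt w|two y /ap_rootP [[w g] Wv ->]].
- have [f0 Wf0] := ap_outcomes data w.
  have /nt /ap_forest_movesP [_ [[w1 f] [[w2 f'] []]]] :
      is_root F supset (ap_node W \bot%O (w, f0)).
    by apply/ap_rootP; exists (w, f0).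
  move=> [Wf /= w1w _] [Wf' /= w2w _] neq; subst w1 w2.
  exists f, f'; split=> //.
  by move=> ff'; apply: neq; rewrite ff'.
- have [f [f' [ff' Wf Wf']]] := two w.
  apply/ap_forest_movesP; split; first exact: ap_forest_node.
  by exists (w, f), (w, f'); split;
    [split=> // s; rewrite ltx0|split=> // s; rewrite ltx0|case].
Qed.

End ActionPathSDF.

Theorem theorem2p15 (d : measure_display) (Omega : measurableType d)
    (R : realType) (I : finType) (A : I -> metricType R)
    (dT : Order.disp_t) (T : bOrderType dT)
    (W : set (Omega * (T -> prod_topology A))) :
  is_action_path_sdf_data W ->
  [/\ is_sdf (ap_forest W) ap_proj (ap_random_moves W),
      order_consistent (ap_random_moves W),
      is_maximal_sdf (ap_forest W) ap_proj (ap_random_moves W)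
    & surely_nontrivial (ap_forest W) <->
      (forall w : Omega, exists f f' : T -> prod_topology A,
         [/\ f <> f', W (w, f) & W (w, f')])].
Proof.
move=> data; split.
- exact: ap_sdf.
- exact: ap_order_consistent.
- exact: ap_maximal_sdf.
- exact: ap_surely_nontrivialP.
Qed.
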